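(* Let $n$ be an integer greater than $1$ and let $d$ be a positive integer. A $d$-tupling function is base-$n$ perfect if and only if it has base-$n$ shells.
   Context: $\mathbb{N}$ denotes the non-negative integers. A $d$-tupling function is a bijection $f\colon\mathbb{N}^d\to\mathbb{N}$. For $x\in\mathbb{N}$, $\operatorname{len}_n(x)=\lceil\log_n(x+1)\rceil$. A $d$-tupling function $f$ is base-$n$ perfect if for all non-negative integers $x_1,\ldots,x_d,k$ with $\operatorname{len}_n(x_i)\le k$ for all $i$, one has $\operatorname{len}_n(f(x_1,\ldots,x_d))\le dk$. A function $s\colon\mathbb{N}^d\to\mathbb{N}$ is a shell numbering for $f$ if for all $\mathbf{x},\mathbf{y}\in\mathbb{N}^d$, $s(\mathbf{x})<s(\mathbf{y})$ implies $f(\mathbf{x})<f(\mathbf{y})$. $f$ has base-$n$ shells if $\max(\operatorname{len}_n(x_1),\ldots,\operatorname{len}_n(x_d))$ is a shell numbering for $f$. *)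

(* Defs.v *)
From mathcomp Require Import all_boot all_order all_algebra.
From mathcomp Require Import reals exp.

Set Implicit Arguments.
Unset Strict Implicit.
Unset Printing Implicit Defensive.

Definition tupling_function (d : nat) (f : {ffun 'I_d -> nat} -> nat) : Prop :=
  bijective f.

(* For 1 < n, [up_log n m] is the ceiling of the base-n logarithm of m > 0;
   [len_ceil_log] below relates it to the real logarithm. *)
Definition len (n x : nat) : nat := up_log n x.+1.

Definition base_perfect (n d : nat) (f : {ffun 'I_d -> nat} -> nat) : Prop :=
  forall (x : {ffun 'I_d -> nat}) (k : nat),
    (forall i : 'I_d, len n (x i) <= k) -> len n (f x) <= d * k.

Definition shell_numbering (d : nat) (f s : {ffun 'I_d -> nat} -> nat) : Prop :=
  forall x y : {ffun 'I_d -> nat}, s x < s y -> f x < f y.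

Definition has_base_shells (n d : nat) (f : {ffun 'I_d -> nat} -> nat) : Prop :=
  shell_numbering f (fun x => \max_(i < d) len n (x i)).

Import Order.TTheory GRing.Theory Num.Theory.
Local Open Scope ring_scope.

Lemma len_ceil_log (R : realType) (n x : nat) : (1 < n)%N ->
  (len n x)%:Z = Num.ceil (ln (x.+1%:R : R) / ln (n%:R : R)).
Proof.
move=> n1.
have lnn : 0 < ln (n%:R : R) by rewrite ln_gt0 // ltr1n.
have lnX k : ln ((n ^ k)%N%:R : R) = k%:R * ln (n%:R : R).
  by rewrite natrX lnXn ?ltr0n 1?ltnW // mulr_natl.
have pX k : (0 : R) < (n ^ k)%N%:R by rewrite ltr0n expn_gt0 ltnW.
have p1 : (0 : R) < x.+1%:R by rewrite ltr0n.
apply/esym/ceil_def/andP; split; last first.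
  rewrite -pmulrn ler_pdivrMr // -lnX ler_ln ?posrE // ler_nat.
  exact: up_logP.
rewrite /len; case: x p1 => [|x] p1.
  by rewrite up_log1 ln1 mul0r sub0r ltrN10.
have u0 : (0 < up_log n x.+2)%N by rewrite up_log_gt0 n1.
have -> : (up_log n x.+2)%:Z - 1 = ((up_log n x.+2).-1)%:Z.
  by rewrite -[in LHS](prednK u0) -addn1 PoszD addrK.
rewrite -pmulrn ltr_pdivlMr // -lnX ltr_ln ?posrE // ltr_nat.
exact: up_log_gtn.
Qed.

(* Main.v *)
(* The vectors whose coordinates all have length at most k form a box of exactly
   n^(dk) elements.  Being base-n perfect says that f maps each such box into
   [0, n^(dk)), hence, by counting, onto it; this is the same as f enumerating
   each box before its complement. *)
Require Import Defs.
From mathcomp Require Import all_boot.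

Lemma len_leq (n x k : nat) : 1 < n -> (len n x <= k) = (x < n ^ k).
Proof.
move=> n1; apply/idP/idP => [le_k|lt_x]; last exact: up_log_min.
by apply: leq_trans (up_logP x.+1 n1) _; rewrite leq_exp2l.
Qed.

Lemma max_len_leq (n d k : nat) (x : {ffun 'I_d -> nat}) : 1 < n ->
  reflect (forall i, x i < n ^ k) (\max_(i < d) len n (x i) <= k).
Proof.
move=> n1; apply: (iffP (bigmax_leqP _ _ _)) => H i; first by rewrite -len_leq ?H.
by move=> _; rewrite len_leq.
Qed.

(** An injection between finite sets of equal size [b ^ d] is onto, so [f y] is already the image of
    a point of the box; injectivity of [f] identifies that point with [y]. *)
Lemma injective_box_surj (d b : nat) (f : {ffun 'I_d -> nat} -> nat) :
    injective f ->
    (forall x : {ffun 'I_d -> nat}, (forall i, x i < b) -> f x < b ^ d) ->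
  forall y, f y < b ^ d -> forall i, y i < b.
Proof.
move=> finj fbox y fy.
pose emb (z : {ffun 'I_d -> 'I_b}) := [ffun i => val (z i)].
have emb_box z i : emb z i < b by rewrite ffunE ltn_ord.
pose h z := Ordinal (fbox _ (emb_box z)).
have hinj : injective h.
  move=> z1 z2 /(congr1 val) /= /finj /ffunP e; apply/ffunP => i.
  by apply: val_inj; have := e i; rewrite !ffunE.
have [|g _ gK] := inj_card_bij hinj; first by rewrite card_ffun !card_ord.
have /(congr1 val) /= /finj <- := gK (Ordinal fy).
exact: emb_box.
Qed.

(** Pigeonhole, indexed by ['I_m] to suit the inverse of a tupling function on an initial
    segment. *)
Lemma injective_to_box_leq (d b m : nat) (g : 'I_m -> {ffun 'I_d -> nat}) :
  injective g -> (forall j i, g j i < b) -> m <= b ^ d.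
Proof.
move=> ginj gbox.
pose h j := [ffun i => Ordinal (gbox j i)].
have hinj : injective h.
  move=> j1 j2 /ffunP e; apply: ginj; apply/ffunP => i.
  by have := congr1 val (e i); rewrite !ffunE.
by have := leq_card h hinj; rewrite card_ffun !card_ord.
Qed.

Theorem theorem2p5 (n d : nat) (hn : 1 < n) (hd : 0 < d)
    (f : {ffun 'I_d -> nat} -> nat) (hf : tupling_function f) :
  base_perfect n f <-> has_base_shells n f.
Proof.
case: (hf) => g fK gK; split=> [perf x y lt_xy|shells x k lex].
- set k := \max_(i < d) len n (x i) in lt_xy.
  have fbox (z : {ffun 'I_d -> nat}) : (forall i, z i < n ^ k) -> f z < (n ^ k) ^ d.
    by move=> zbox; rewrite -expnM mulnC -len_leq //; apply: perf => i; rewrite len_leq.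
  have fx : f x < (n ^ k) ^ d by apply: fbox; apply/max_len_leq.
  (* If [f y <= f x], then [f y] is below the box bound too, which puts [y] in the box of side
     [n ^ k], against [lt_xy]. *)
  rewrite ltnNge; apply/negP => le_f; move: lt_xy; rewrite ltnNge => /negP; apply.
  apply/max_len_leq => //; apply: (injective_box_surj _ _ _ (can_inj fK) fbox).
  exact: leq_ltn_trans le_f fx.
- rewrite len_leq // mulnC expnM.
  (* The strict bound on [f x] is a count of the [(f x).+1] distinct preimages of 0, ..., [f x]. *)
  apply: (@injective_to_box_leq _ _ _ (fun j : 'I_(f x).+1 => g j)).
    by move=> j1 j2 /(can_inj gK) /val_inj.
  move=> j; apply/(@max_len_leq n d k) => //; rewrite leqNgt; apply/negP => lt_k.
  (* A preimage [g j] outside the box would lie in a later shell than [x], giving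
     [f x < f (g j) = j]. *)
  have /shells : \max_(i < d) len n (x i) < \max_(i < d) len n (g j i).
    by apply: leq_ltn_trans lt_k; apply/bigmax_leqP => i _; apply: lex.
  by rewrite gK ltnNge -ltnS ltn_ord.
Qed.
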